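(* Let $m\ge 1$ be an integer and let $\Sigma=(a_1,\ldots,a_n)$ be an $m$-th evaluation distinct sequence in $\mathbb{Z}$ (respectively, in $\mathbb{R}$) that is $M$-bounded. Then $$M>\frac{2^{1-\frac1m}\,((m-1)!)^{\frac1m}}{3^{\frac1{2m}}}\cdot\frac{2^{\frac nm}}{n^{1-\frac1{2m}}}\,(1+o(1)).$$
   Context: Here $[1,n]=\{1,\ldots,n\}$. A sequence $\Sigma=(a_1,\ldots,a_n)$ is $M$-bounded if $a_i\in[0,M]$ for every $i$. For $A\subseteq[1,n]$, $$e^m_{\Sigma}(A)=\sum_{\{i_1<\cdots<i_m\}\subseteq A}a_{i_1}\cdots a_{i_m},$$ with the convention $e^m_\Sigma(A)=0$ if $|A|<m$. A sequence of integers is $m$-th evaluation distinct if $e^m_\Sigma(A_1)\ne e^m_\Sigma(A_2)$ for all distinct $A_1,A_2\subseteq[1,n]$ of size at least $m$. A sequence of real numbers is $m$-th evaluation distinct if $|e^m_\Sigma(A_1)-e^m_\Sigma(A_2)|\ge 1$ for all distinct $A_1,A_2\subseteq[1,n]$ of size at least $m$. $o(1)$ denotes a quantity tending to $0$ as $n\to\infty$ with $m$ fixed, uniformly in $\Sigma$ and $M$. *)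

(* Defs.v *)
From mathcomp Require Import all_boot all_order all_algebra.
From mathcomp Require Import all_classical all_reals all_analysis.
Import Order.TTheory GRing.Theory Num.Theory.
Import numFieldNormedType.Exports.
Set Implicit Arguments.
Unset Strict Implicit.
Unset Printing Implicit Defensive.
Local Open Scope ring_scope.

(* [Sigma] is indexed from 0, i.e. by 'I_n in place of [1, n].  The sum is
   empty, hence 0, when #|A| < m. *)
Definition evaluation (T : comNzRingType) (n m : nat) (Sigma : 'I_n -> T)
    (A : {set 'I_n}) : T :=
  \sum_(B : {set 'I_n} | (B \subset A) && (#|B| == m)) \prod_(i in B) Sigma i.

Definition evaluation_distinct_int (n m : nat) (Sigma : 'I_n -> int) : Prop :=
  forall A1 A2 : {set 'I_n}, (m <= #|A1|)%N -> (m <= #|A2|)%N -> A1 != A2 ->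
    evaluation m Sigma A1 != evaluation m Sigma A2.

Definition evaluation_distinct_real (R : realType) (n m : nat)
    (Sigma : 'I_n -> R) : Prop :=
  forall A1 A2 : {set 'I_n}, (m <= #|A1|)%N -> (m <= #|A2|)%N -> A1 != A2 ->
    1 <= `|evaluation m Sigma A1 - evaluation m Sigma A2|.

Definition bounded_seq (R : realType) (n : nat) (M : R) (Sigma : 'I_n -> R)
    : Prop :=
  forall i : 'I_n, 0 <= Sigma i <= M.

Definition main_term (R : realType) (m n : nat) : R :=
  (2 `^ (1 - 1 / m%:R) * ((m.-1)`!%:R) `^ (1 / m%:R)) / 3 `^ (1 / (2 * m%:R))
  * (2 `^ (n%:R / m%:R) / n%:R `^ (1 - 1 / (2 * m%:R))).

(* Main.v *)
(* Second moment method.  Let A be a uniformly random subset and X = e^m(A).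
   The at least (1 - o(1)) 2^n subsets of size >= m give values of X that are
   1-separated, so E(X - c)^2 >= (1 - o(1)) 4^n / 12 for every c.  On the other
   hand, since the a_i are nonnegative and bounded by M, expanding the variance
   over pairs (B, B') of m-sets bounds it by
     M^(2m) 4^-m \sum_(B, B') (2^#|B :&: B'| - 1)
       = M^(2m) 4^-m \sum_(1 <= k <= m) 'C(n, k) 'C(n - k, m - k)^2,
   where k = 1 contributes at most n^(2m - 1) / ((m - 1)!)^2 and the other k
   contribute O(n^(2m - 2)). *)
Require Import Defs.
From mathcomp Require Import all_boot all_order all_algebra.
From mathcomp Require Import all_classical all_reals all_analysis.
From mathcomp Require Import finset ring lra zify.
Import Order.TTheory GRing.Theory Num.Theory.
Import numFieldNormedType.Exports.
Local Open Scope ring_scope.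

(** * Sums of squares of 1-separated values *)

Section Separated.
Variables (R : realFieldType) (I : finType) (f : I -> R).

(** Induction on [k]: the largest value on the rest of [T] is at least 1 below [f i], and the
    descent continues from there. *)
Lemma separated_spread (k : nat) (T : {set I}) (i : I) :
  #|T| = k -> i \in T ->
  {in T &, forall x y, x != y -> 1 <= `|f x - f y|} ->
  {in T, forall x, f x <= f i} ->
  exists2 j, j \in T & k%:R - 1 <= f i - f j.
Proof.
elim: k T i => [|k IHk] T i cardT iT sepT maxi.
  by move/eqP: cardT iT; rewrite cards_eq0 => /eqP ->; rewrite inE.
have cardT' : #|T :\ i| = k by move: cardT; rewrite (cardsD1 i) iT => -[].
have [T0|[j0 j0T]] := set_0Vmem (T :\ i).
  by exists i => //; rewrite -cardT' T0 cards0 !subrr.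
have [j jT0 maxj] := arg_maxP f j0T; have jT : j \in T :\ i := jT0.
have sub x : x \in T :\ i -> x \in T by rewrite !inE => /andP[].
have [l lT gap] : exists2 l, l \in T :\ i & k%:R - 1 <= f j - f l.
  by apply: IHk => // x y /sub xT /sub yT; exact: sepT.
exists l; first exact: sub.
have := sepT i j iT (sub _ jT).
rewrite eq_sym; have /setD1P[-> _] := jT.
move=> /(_ isT); rewrite ger0_norm ?subr_ge0 ?maxi ?sub // -natr1.
by move: gap; lra.
Qed.

(* The two extreme values differ by at least #|T| - 1, so they contribute at
   least (#|T| - 1)^2 / 2 whatever c is; remove them and iterate. *)
Lemma separated_sum_sqr (T : {set I}) (c : R) :
  {in T &, forall x y, x != y -> 1 <= `|f x - f y|} ->
  (#|T|%:R ^+ 3 - #|T|%:R) / 12 <= \sum_(x in T) (f x - c) ^+ 2.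
Proof.
have [k] := ubnP #|T|; elim: k T => // k IHk T cardT sepT.
have [T0|[i0 i0T]] := set_0Vmem T.
  by rewrite T0 cards0 big_set0 expr0n /= subr0 mul0r.
have [i iT0 maxi] := arg_maxP f i0T; have iT : i \in T := iT0.
have [j jT gap] := separated_spread _ _ _ erefl iT sepT maxi.
have [ji|neq_ji] := eqVneq j i.
  have T1 : #|T| = 1%N.
    apply/eqP; rewrite eqn_leq card_gt0; apply/andP; split; last first.
      by apply/set0Pn; exists i.
    by rewrite -(ler_nat R); move: gap; rewrite ji subrr subr_le0.
  by rewrite T1 expr1n subrr mul0r sumr_ge0 // => x _; exact: sqr_ge0.
have jTi : j \in T :\ i by rewrite !inE neq_ji.
rewrite (big_setD1 i) //= (big_setD1 j) //=.
have cardE : #|T| = (#|T :\ i :\ j|).+2.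
  by rewrite (cardsD1 i) iT (cardsD1 j) jTi.
have sub x : x \in T :\ i :\ j -> x \in T by rewrite !inE => /and3P[].
have := IHk (T :\ i :\ j) _ _.
have -> : (#|T :\ i :\ j| < k)%N by move: cardT; rewrite cardE ltnS => /ltnW.
move=> /(_ isT (fun x y xT yT => sepT x y (sub x xT) (sub y yT))).
have cardR : #|T|%:R = #|T :\ i :\ j|%:R + 2 :> R by rewrite cardE -natrD addn2.
move: gap; rewrite cardR.
set s := \sum_(_ in _) _; have := ler0n R #|T :\ i :\ j|.
set t := _%:R; move=> t0 gap IH.
(* Going from t to t + 2 points raises the left side by (t + 1)^2 / 2, while (a - c)^2 + (b - c)^2 =
   ((a - b)^2 + (a + b - 2c)^2) / 2. *)
have : (t + 1) ^+ 2 <= (f i - f j) ^+ 2.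
  by rewrite ler_pXn2r // ?nnegrE; lra.
have := sqr_ge0 (f i + f j - 2 * c).
move: IH; set a := f i; set b := f j => IH; lra.
Qed.
End Separated.

(** * Counting sets by size, and binomial estimates *)

Section Counting.
Variable I : finType.
Implicit Types A B S : {set I}.

Lemma card_supersets (B : {set I}) :
  #|[set A : {set I} | B \subset A]| = (2 ^ (#|I| - #|B|))%N.
Proof.
have -> : (#|I| - #|B|)%N = #|~: B| by rewrite -(cardsC B) addKn.
rewrite -card_powerset -(card_imset _ (can_inj (@setCK I))).
apply: eq_card => A; rewrite [RHS]inE; apply/imsetP/idP => [[A' + ->]|].
  by rewrite inE setCS.
by exists (~: A); rewrite ?setCK // inE -setCS setCK.
Qed.

Lemma card_supersets_draws S (m : nat) : (#|S| <= m)%N ->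
  #|[set B : {set I} | S \subset B & #|B| == m]| =
  'C(#|I| - #|S|, m - #|S|).
Proof.
move=> Sm; have -> : (#|I| - #|S|)%N = #|~: S| by rewrite -(cardsC S) addKn.
rewrite -cards_draws.
set X := [set A : {set I} | A \subset ~: S & _].
have <- : [set S :|: A | A in X] =
    [set B : {set I} | S \subset B & #|B| == m].
  apply/setP => B; rewrite inE; apply/imsetP/andP => [[A]|[SB /eqP Bm]].
    rewrite inE => /andP[AS /eqP cardA] ->; rewrite subsetUl cardsU cardA.
    have /eqP -> : S :&: A == set0.
      by rewrite setI_eq0 disjoint_sym disjoints_subset.
    by rewrite cards0 subn0 subnKC.
  exists (B :\: S); last first.
    by rewrite setDE setUIr setUCr setIT; apply/esym/setUidPr.
  by rewrite inE subsetDr cardsD (setIidPr SB) Bm eqxx.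
have setUSK A : A \subset ~: S -> (S :|: A) :&: ~: S = A.
  by move=> /setIidPl AS; rewrite setIUl setICr set0U.
rewrite card_in_imset // => A A'; rewrite !inE => /andP[AS _] /andP[AS' _] eqU.
by rewrite -(setUSK A) // eqU setUSK.
Qed.

Lemma sum_card_draws (m : nat) (F : nat -> nat) :
  (\sum_(S : {set I} | 0 < #|S| <= m) F #|S|
   = \sum_(k < m.+1 | 0 < k) 'C(#|I|, k) * F k)%N.
Proof.
(* The default value of [inord] is never met, since only sets of size at most [m] are summed
   over. *)
rewrite (partition_big (fun S : {set I} => inord #|S| : 'I_m.+1)
  (fun k => (0 < k)%N)) /=; last by move=> S /andP[S0 Sm]; rewrite inordK.
apply: eq_bigr => k k0; rewrite -card_draws -sum_nat_const.
apply: eq_big => [S|S /andP[/andP[S0 Sm] /eqP <-]]; last by rewrite inordK.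
rewrite inE; apply/idP/eqP => [/andP[/andP[S0 Sm] /eqP <-]|Sk].
  by rewrite inordK.
by rewrite Sk k0 -ltnS ltn_ord /=; apply/eqP/val_inj; rewrite /= inordK.
Qed.
End Counting.

Lemma leq_ffact_exp (n k : nat) : (n ^_ k <= n ^ k)%N.
Proof.
elim: k => // k IHk.
by rewrite ffactnSr expnSr leq_mul // leq_subr.
Qed.

Lemma leq_bin_exp (n k : nat) : ('C(n, k) <= n ^ k)%N.
Proof.
by apply: leq_trans (leq_ffact_exp n k); rewrite -bin_ffact leq_pmulr ?fact_gt0.
Qed.

(** Here m = p + 1. Multiplied by p!^2, the term k = 1 becomes n ((n - 1)^_p)^2 <= n^(2p + 1). Each
    of the p terms with k >= 2 is at most n^k n^(2(m - k)) = n^(2m - k) <= n^(2p). *)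
Lemma pair_count_bound (n p : nat) : (0 < n)%N ->
  (p`! ^ 2 * \sum_(k < p.+2 | 0 < k) 'C(n, k) * 'C(n - k, p.+1 - k) ^ 2
   <= n ^ p.*2.+1 + p`! ^ 2 * p.+1 * n ^ p.*2)%N.
Proof.
move=> n0; rewrite big_mkcond !big_ord_recl /= add0n mulnDr leq_add //.
  rewrite bin1 !subn1 /= mulnCA -expnMn [(p`! * _)%N]mulnC bin_ffact.
  rewrite [leqRHS]expnS; apply: leq_mul; first by [].
  rewrite -muln2 expnM leq_sqr.
  apply: leq_trans (leq_ffact_exp _ _) _.
  by case: (p) => // q; rewrite leq_exp2r // leq_pred.
rewrite -mulnA leq_mul //.
apply: (@leq_trans (\sum_(i < p) n ^ p.*2)); last first.
  rewrite sum_nat_const card_ord. by apply: leq_mul.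
apply: leq_sum => i _; rewrite /bump /= !add1n.
apply: (@leq_trans (n ^ i.+2 * (n ^ (p.+1 - i.+2)) ^ 2)).
  apply: leq_mul; first exact: leq_bin_exp.
  rewrite leq_sqr.
  apply: leq_trans (leq_bin_exp _ _) _.
  by have [->//|q0] := posnP (p.+1 - i.+2); rewrite leq_exp2r // leq_subr.
by rewrite -expnM -expnD leq_pexp2l //; have := ltn_ord i; lia.
Qed.

(** For j < m, 'C(n, j) (n - j) = (j + 1) 'C(n, j + 1) <= m 2^n, and n <= (n - j) + m, so each of
    the m layers satisfies 'C(n, j) n <= 2 m 2^n. This share O(1/n) of all subsets is small enough
    for the limit. *)
Lemma small_sets_bound (n m : nat) :
  (#|[set A : {set 'I_n} | (#|A| < m)%N]| * n <= 2 * m ^ 2 * 2 ^ n)%N.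
Proof.
have -> : #|[set A : {set 'I_n} | (#|A| < m)%N]| = (\sum_(j < m) 'C(n, j))%N.
  rewrite -sum1_card; under eq_bigl do rewrite inE.
  case: m => [|m]; first by rewrite big_ord0 big_pred0.
  rewrite (partition_big
    (fun S : {set 'I_n} => inord #|S| : 'I_m.+1) predT) //=.
  apply: eq_bigr => j _; rewrite -[in RHS](card_ord n) -card_draws -sum1_card.
  apply: eq_bigl => S; rewrite inE; apply/andP/eqP => [[Sm /eqP <-]|Sj].
    by rewrite inordK.
  by rewrite Sj ltn_ord; split=> //; apply/eqP/val_inj; rewrite /= inordK // Sj.
have binle j : ('C(n, j) <= 2 ^ n)%N.
  rewrite -[n in (2 ^ n)%N]card_ord -cardsT -card_powerset.
  by rewrite -[n in 'C(n, j)]card_ord -cardsT -cards_draws subset_leq_card //;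
    apply/fintype.subsetP => A; rewrite !inE => /andP[].
rewrite big_distrl /=; apply: (@leq_trans (\sum_(j < m) (2 * m) * 2 ^ n)).
  apply: leq_sum => j _.
  have jm := ltn_ord j; apply: (@leq_trans ('C(n, j) * (n - j) + 'C(n, j) * m)).
    by rewrite -mulnDr leq_mul //; lia.
  have Cj : ('C(n, j) * (n - j) <= m * 2 ^ n)%N.
    by rewrite mulnC -mul_bin_left leq_mul.
  by rewrite mul2n -addnn mulnDl leq_add // mulnC leq_mul.
by rewrite sum_nat_const card_ord mulnA leq_mul //; lia.
Qed.

(** * The variance of the evaluation at a random subset *)

(* With A uniform, this is 2^n times the covariance of [B \subset A] and
   [B' \subset A]. *)
Lemma sum_centered_subset (R : realFieldType) (n m : nat) (B B' : {set 'I_n}) :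
  #|B| = m -> #|B'| = m ->
  \sum_(A : {set 'I_n})
    ((B \subset A)%:R - 2 ^- m) * ((B' \subset A)%:R - 2 ^- m) =
  2 ^+ n / 2 ^+ (2 * m) * (2 ^+ #|B :&: B'| - 1) :> R.
Proof.
move=> cardB cardB'.
have sumE (C : {set 'I_n}) :
    \sum_(A : {set 'I_n}) (C \subset A)%:R = 2 ^+ n / 2 ^+ #|C| :> R.
  rewrite -natr_sum -big_mkcond sum1_card -exprB ?unitfE //; last first.
    by rewrite -[n in (_ <= n)%N]card_ord max_card.
  rewrite -natrX; congr _%:R.
  have := card_supersets _ C; rewrite card_ord => <-.
  by apply: eq_card => A; rewrite !inE.
(* The constant 1 is written as an indicator for [set0], so that [sumE] evaluates all four sums. *)
transitivity (\sum_(A : {set 'I_n}) ((B :|: B' \subset A)%:R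
    - 2 ^- m * (B \subset A)%:R - 2 ^- m * (B' \subset A)%:R
    + 2 ^- m * 2 ^- m * (set0 \subset A)%:R) : R).
  by apply: eq_bigr => A _; rewrite sub0set mulr1 subUset -mulnb natrM; ring.
rewrite big_split !sumrB /= -!mulr_sumr !sumE cards0 expr0 divr1 cardB cardB'.
have : (2 : R) ^+ #|B :|: B'| * 2 ^+ #|B :&: B'| = 2 ^+ m * 2 ^+ m.
  by rewrite -!exprD cardsUI cardB cardB'.
rewrite mul2n -addnn exprD.
have neq0 k : (2 : R) ^+ k != 0 by rewrite expf_neq0.
have := neq0 m; have := neq0 #|B :|: B'|.
move: (2 ^+ #|_ :|: _|) (2 ^+ #|_ :&: _|) (2 ^+ m) (2 ^+ n) => u v w x u0 w0 uv.
have -> : v = w * w / u by rewrite -uv mulrAC divff ?mul1r.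
by field; rewrite u0 w0.
Qed.

(* 2 ^ #|B :&: B'| - 1 counts the nonempty S included in both B and B', so the
   sum can be taken over S first. *)
Lemma sum_pow_card_setI (R : realFieldType) (n m : nat) :
  \sum_(B : {set 'I_n} | #|B| == m) \sum_(B' : {set 'I_n} | #|B'| == m)
    (2 ^+ #|B :&: B'| - 1) =
  (\sum_(k < m.+1 | 0 < k) 'C(n, k) * 'C(n - k, m - k) ^ 2)%N%:R :> R.
Proof.
transitivity (\sum_(B : {set 'I_n} | #|B| == m)
  \sum_(B' : {set 'I_n} | #|B'| == m) \sum_(S : {set 'I_n} | (0 < #|S| <= m)%N)
    ((S \subset B) && (S \subset B'))%:R : R).
  apply: eq_bigr => B /eqP cardB; apply: eq_bigr => B' cardB'.
  have sumS : (\sum_(S : {set 'I_n}) (S \subset B :&: B') = 2 ^ #|B :&: B'|)%N.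
    rewrite -big_mkcond sum1_card -card_powerset.
    by apply: eq_card => S; rewrite !inE.
  (* The term [set0] cancels the - 1; the cap #|S| <= m is automatic for S included in B. *)
  rewrite -natrX -sumS (bigD1 set0) //= sub0set natrD addrC addKr natr_sum.
  rewrite [LHS]big_mkcond [RHS]big_mkcond /=; apply: eq_bigr => S _.
  rewrite -subsetI card_gt0; case: eqVneq => //= _.
  case: leqP => //= mS; case: (boolP (_ \subset _)) => //= /subset_leq_card.
  by rewrite leqNgt (leq_ltn_trans _ mS) // -cardB subset_leq_card // subsetIl.
under eq_bigr do rewrite exchange_big /=.
rewrite exchange_big /=.
rewrite -[in RHS](card_ord n).
rewrite -(sum_card_draws _ _ (fun k => 'C(#|'I_n| - k, m - k) ^ 2)%N).
rewrite natr_sum; apply: eq_bigr => S /andP[_ Sm].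
(* For fixed S the double sum factors into the square of the number of m-sets containing S. *)
under eq_bigr do under eq_bigr do rewrite -mulnb natrM.
rewrite -big_distrlr /= -natr_sum -natrM mulnn; congr (_ ^ 2)%:R.
rewrite -card_supersets_draws // -sum1_card.
under [RHS]eq_bigl do rewrite inE andbC.
by rewrite [RHS]big_mkcondr; apply: eq_bigr => B _; case: (S \subset B).
Qed.

(** The witness is the mean of the evaluation. All the covariances are nonnegative, so each
    coefficient [p B * p B'] may be replaced by its upper bound M^(2m). *)
Lemma evaluation_variance (R : realFieldType) (n m : nat) (Sigma : 'I_n -> R)
    (M : R) :
  (forall i, 0 <= Sigma i <= M) ->
  exists mu : R, \sum_(A : {set 'I_n}) (evaluation m Sigma A - mu) ^+ 2 <=
    2 ^+ n / 2 ^+ (2 * m) * M ^+ (2 * m) *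
    (\sum_(k < m.+1 | 0 < k) 'C(n, k) * 'C(n - k, m - k) ^ 2)%N%:R.
Proof.
move=> boundedSigma; pose p (B : {set 'I_n}) := \prod_(i in B) Sigma i.
pose mu := \sum_(B : {set 'I_n} | #|B| == m) p B * 2 ^- m; exists mu.
have evalE A : evaluation m Sigma A - mu
   = \sum_(B : {set 'I_n} | #|B| == m) p B * ((B \subset A)%:R - 2 ^- m).
  rewrite /evaluation; under eq_bigl do rewrite andbC.
  rewrite big_mkcondr -sumrB; apply: eq_bigr => B _.
  by rewrite mulrBr; case: (B \subset A); rewrite ?mulr1 ?mulr0.
under eq_bigr do rewrite evalE expr2 big_distrlr.
rewrite exchange_big /=; under eq_bigr do rewrite exchange_big /=.
rewrite -sum_pow_card_setI mulr_sumr; apply: ler_sum => B /eqP cardB.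
rewrite mulr_sumr; apply: ler_sum => B' /eqP cardB'.
under eq_bigr do rewrite mulrACA.
rewrite -mulr_sumr (sum_centered_subset R n m) // mulrA [_ * (_ / _)]mulrC.
have pM (C : {set 'I_n}) : 0 <= p C <= M ^+ #|C|.
  rewrite prodr_ge0 => [|i _]; last by case/andP: (boundedSigma i).
  by rewrite -prodr_const ler_prod.
rewrite ler_wpM2r ?subr_ge0 ?exprn_ege1 ?ler1n //.
rewrite ler_wpM2l ?divr_ge0 ?exprn_ge0 //.
have := pM B; have := pM B'; rewrite cardB cardB' mul2n -addnn exprD.
by move=> /andP[? ?] /andP[? ?]; rewrite ler_pM.
Qed.

(** * Powers of the main term *)

Lemma powRXn (R : realType) (a x : R) (k : nat) :
  (a `^ x) ^+ k = a `^ (x * k%:R).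
Proof. by rewrite powRrM powR_mulrn // powR_ge0. Qed.

(** The exponent 2m clears every fractional exponent, which leaves a rational expression to compare
    with the variance bounds. *)
Lemma main_term_pow (R : realType) (p n : nat) : (0 < n)%N ->
  main_term R p.+1 n ^+ (2 * p.+1) =
  4 ^+ p * p`!%:R ^+ 2 / 3 * (4 ^+ n / n%:R ^+ p.*2.+1).
Proof.
move=> n0; have p1 : p.+1%:R != 0 :> R by rewrite pnatr_eq0.
rewrite /main_term !(exprMn, exprVn, powRXn) natrM.
have -> : (1 - 1 / p.+1%:R) * (2 * p.+1%:R) = (2 * p)%:R :> R.
  by rewrite natrM -natr1; field; rewrite natr1.
have -> : 1 / p.+1%:R * (2 * p.+1%:R) = 2%:R :> R by field.
have -> : 1 / (2 * p.+1%:R) * (2 * p.+1%:R) = 1%:R :> R by field.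
have -> : n%:R / p.+1%:R * (2 * p.+1%:R) = (2 * n)%:R :> R.
  by rewrite natrM; field.
have -> : (1 - 1 / (2 * p.+1%:R)) * (2 * p.+1%:R) = p.*2.+1%:R :> R.
  by rewrite -!natr1 -muln2 natrM; field; rewrite natr1.
rewrite !powR_mulrn // expr1 ![2 ^+ (2 * _)]exprM.
by have -> : (2 : R) ^+ 2 = 4 by ring.
Qed.

Lemma main_term_gt0 (R : realType) (m n : nat) :
  (0 < n)%N -> 0 < main_term R m n.
Proof.
move=> n0; rewrite /main_term.
by rewrite !(mulr_gt0, invr_gt0, powR_gt0) ?ltr0n ?fact_gt0.
Qed.

(** * The error term and its ingredients *)

Definition large_sets (n m : nat) : nat :=
  #|[set A : {set 'I_n} | (m <= #|A|)%N]|.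

(* With m = p + 1, the two variance bounds combine into
   main_term ^ (2m) * variance_ratio <= M ^ (2m); the denominator accounts for
   the terms k >= 2 of the upper bound. *)
Definition variance_ratio (R : realType) (p n : nat) : R :=
  let q : R := (large_sets n p.+1)%:R / 2 ^+ n in
  (q ^+ 3 - q / 4 ^+ n) / (1 + (p`! ^ 2 * p.+1)%:R / n%:R).

(* The summand [- n^-1] makes the final inequality strict. *)
Definition error_term (R : realType) (m n : nat) : R :=
  variance_ratio R m.-1 n - 1 - n%:R^-1.

Lemma large_sets_le (n m : nat) : (large_sets n m <= 2 ^ n)%N.
Proof.
rewrite /large_sets -[in leqRHS](card_ord n) -cardsT -card_powerset.
by apply/subset_leq_card/fintype.subsetP => A _; rewrite inE subsetT.
Qed.

Lemma large_sets_ge (n m : nat) :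
  (2 ^ n * n <= large_sets n m * n + 2 * m ^ 2 * 2 ^ n)%N.
Proof.
suff eqD : (large_sets n m + #|[set A : {set 'I_n} | (#|A| < m)%N]| = 2 ^ n)%N.
  by rewrite -{1}eqD mulnDl leq_add2l small_sets_bound.
rewrite -[in RHS](card_ord n) -cardsT -card_powerset powersetT cardsT.
rewrite -(cardsC [set A : {set 'I_n} | (m <= #|A|)%N]); congr addn.
by apply: eq_card => A; rewrite !inE ltnNge.
Qed.

Lemma variance_ratio_ge0 (R : realType) (p n : nat) : 0 <= variance_ratio R p n.
Proof.
rewrite /variance_ratio; apply: divr_ge0; last first.
  by apply: addr_ge0; rewrite ?divr_ge0.
have -> : (4 : R) ^+ n = 2 ^+ n * 2 ^+ n.
  by rewrite -exprMn; congr (_ ^+ _); ring.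
have t0 : 0 < (2 : R) ^+ n by rewrite exprn_gt0.
(* K^3 - K >= 0 holds because the count K is 0 or at least 1. *)
case: large_sets => [|k]; first by rewrite !mul0r expr0n subrr.
set x : R := k.+1%:R; move: (2 ^+ n) t0 => t t0.
have -> : (x / t) ^+ 3 - x / t / (t * t) = x * (x ^+ 2 - 1) / t ^+ 3.
  by field; rewrite gt_eqF.
apply: divr_ge0; last by rewrite exprn_ge0 // ltW.
by apply: mulr_ge0 => //; rewrite subr_ge0 exprn_ege1 // ler1n.
Qed.

Lemma variance_ratio_le1 (R : realType) (p n : nat) : variance_ratio R p n <= 1.
Proof.
rewrite /variance_ratio; set q := _ / 2 ^+ n.
have q1 : q <= 1.
  by rewrite ler_pdivrMr ?exprn_gt0 // mul1r -natrX ler_nat large_sets_le.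
have q0 : 0 <= q by rewrite divr_ge0 ?exprn_ge0.
have d0 : 0 <= (p`! ^ 2 * p.+1)%:R / n%:R :> R by rewrite divr_ge0.
rewrite ler_pdivrMr ?mul1r; last by lra.
have : q ^+ 3 <= 1 by rewrite exprn_ile1.
have : 0 <= q / 4 ^+ n by rewrite divr_ge0 ?exprn_ge0.
by lra.
Qed.

(** * Comparison of the two variance bounds *)

Lemma main_term_lt_bound (R : realType) (m n : nat) (Sigma : 'I_n -> R)
    (M : R) :
  (0 < m)%N -> (0 < n)%N ->
  evaluation_distinct_real m Sigma -> bounded_seq M Sigma ->
  main_term R m n * (1 + error_term R m n) < M.
Proof.
case: m => // p _ n0 distinct bounded.
have M0 : 0 <= M by have /andP[/le_trans] := bounded (Ordinal n0); apply.
have r0 := variance_ratio_ge0 R p n; have r1 := variance_ratio_le1 R p n.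
have main0 := main_term_gt0 R p.+1 n n0.
suff : main_term R p.+1 n * variance_ratio R p n <= M.
  apply: lt_le_trans; rewrite ltr_pM2l // /error_term /=.
  by have : 0 < (n%:R^-1 : R); [rewrite invr_gt0 ltr0n|lra].
suff : (main_term R p.+1 n * variance_ratio R p n) ^+ (2 * p.+1) <=
    M ^+ (2 * p.+1).
  by rewrite ler_pXn2r ?nnegrE // mulr_ge0 // ltW.
(* Since 0 <= r <= 1, r ^ (2m) <= r: no 2m-th root of r is needed. *)
rewrite exprMn; apply: (@le_trans _ _
  (main_term R p.+1 n ^+ (2 * p.+1) * variance_ratio R p n)).
  by rewrite ler_wpM2l ?ler_iXnr // exprn_ge0 // ltW.
have [mu] := evaluation_variance R n p.+1 Sigma M bounded.
set W := (\sum_(_ < _ | _) _)%N => varX.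
pose T := [set A : {set 'I_n} | (p.+1 <= #|A|)%N].
have sepT : {in T &, forall A A', A != A' ->
    1 <= `|evaluation p.+1 Sigma A - evaluation p.+1 Sigma A'|}.
  by move=> A A'; rewrite !inE => hA hA'; exact: distinct.
have varT : ((large_sets n p.+1)%:R ^+ 3 - (large_sets n p.+1)%:R) / 12 <=
    \sum_(A : {set 'I_n}) (evaluation p.+1 Sigma A - mu) ^+ 2.
  apply: le_trans (separated_sum_sqr R _ (evaluation p.+1 Sigma) T mu sepT) _.
  rewrite [leRHS](bigID (mem T)) /= lerDl sumr_ge0 // => A _; exact: sqr_ge0.
have {varX varT} := le_trans varT varX.
have : (p`! ^ 2 * W <= _)%N := pair_count_bound n p n0.
rewrite -(ler_nat R) natrM natrD !natrM !natrX -[p`!%:R * _]expr2.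
rewrite main_term_pow // /variance_ratio natrM natrX.
have -> : (4 : R) ^+ n = 2 ^+ n * 2 ^+ n.
  by rewrite -exprMn; congr (_ ^+ _); ring.
have -> : (2 : R) ^+ (2 * p.+1) = 4 * 4 ^+ p.
  by rewrite exprM -exprS; congr (_ ^+ _); ring.
have : 0 <= M ^+ (2 * p.+1) by rewrite exprn_ge0.
have N0 : 0 < n%:R :> R by rewrite ltr0n.
have : 0 < (2 : R) ^+ n by rewrite exprn_gt0.
have : 0 < (4 : R) ^+ p by rewrite exprn_gt0.
have : 0 < (p`!%:R : R) ^+ 2 by rewrite exprn_gt0 // ltr0n fact_gt0.
have : 0 < n%:R ^+ p.*2 :> R by rewrite exprn_gt0.
rewrite [n%:R ^+ p.*2.+1]exprS.
move: (M ^+ (2 * p.+1)) ((2 : R) ^+ n) ((4 : R) ^+ p) ((p`!%:R : R) ^+ 2).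
move: ((n%:R : R) ^+ p.*2) ((large_sets n p.+1)%:R : R).
move: (n%:R : R) N0 (p.+1%:R : R) (ler0n R p.+1) (W%:R : R).
(* N = n, P = p + 1, w = W, X = n^(2p), K counts the large sets, Mm = M^(2m), t = 2^n, f = 4^p and D
   = p!^2. *)
move=> N N0 P P0 w X K Mm t f D X0 D0 f0 t0 Mm0 wle Kle.
have DP0 : 0 <= D * P by rewrite mulr_ge0 // ltW.
have NX0 : 0 < N * X by rewrite mulr_gt0.
have Z0 : 0 < N * X + D * P * X.
  by apply: (ltr_wpDr _ NX0); rewrite mulr_ge0 // ltW.
(* The left side is a nonnegative multiple of the lower bound in [Kle]. After [Kle] is applied, what
   remains is Mm times a quotient that [wle] bounds by 1. *)
have -> : f * D / 3 * (t * t / (N * X)) *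
    (((K / t) ^+ 3 - K / t / (t * t)) / (1 + D * P / N)) =
    (K ^+ 3 - K) / 12 * (4 * f * D / (t * (N * X + D * P * X))).
  by field; rewrite !gt_eqF // ltr_wpDr.
apply: (@le_trans _ _ (t / (4 * f) * Mm * w *
    (4 * f * D / (t * (N * X + D * P * X))))).
  by rewrite ler_wpM2r // divr_ge0 ?mulr_ge0 ?ltW.
have -> : t / (4 * f) * Mm * w * (4 * f * D / (t * (N * X + D * P * X))) =
    Mm * (D * w / (N * X + D * P * X)).
  by field; rewrite !gt_eqF //.
by rewrite ler_piMr // ler_pdivrMr // mul1r.
Qed.

(** * Convergence of the error term to 0 *)

Local Open Scope classical_set_scope.
Local Open Scope ring_scope.

Lemma natr_inv_cvg0 (R : realType) : n%:R^-1 @[n --> \oo] --> (0 : R).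
Proof.
apply/gtr0_cvgV0; last exact: cvgr_idn.
by near=> n; rewrite ltr0n; near: n; exact: nbhs_infty_gt.
Unshelve. all: by end_near. Qed.

Lemma large_sets_cvg (R : realType) (m : nat) :
  (large_sets n m)%:R / 2 ^+ n @[n --> \oo] --> (1 : R).
Proof.
have lower (n : nat) : (0 < n)%N ->
    1 - (2 * m ^ 2)%:R / n%:R <= (large_sets n m)%:R / 2 ^+ n :> R.
  move=> n0; have N0 : 0 < n%:R :> R by rewrite ltr0n.
  have t0 : 0 < (2 : R) ^+ n by rewrite exprn_gt0.
  have := large_sets_ge n m; move: (2 * m ^ 2)%N (large_sets n m) => c L.
  rewrite -(ler_nat R) natrM natrD !(natrM _ L, natrM _ c) natrX => le_tn.
  rewrite lerBlDr -(ler_pM2r (mulr_gt0 t0 N0)) mul1r.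
  have -> : (L%:R / 2 ^+ n + c%:R / n%:R) * (2 ^+ n * n%:R)
      = L%:R * n%:R + c%:R * 2 ^+ n :> R by field; rewrite !gt_eqF.
  exact: le_tn.
apply: (@squeeze_cvgr _ _ _ _
  (fun n : nat => 1 - (2 * m ^ 2)%:R / n%:R) (fun=> 1)).
- near=> n; rewrite lower /=; last by near: n; exact: nbhs_infty_gt.
  by rewrite ler_pdivrMr ?exprn_gt0 // mul1r -natrX ler_nat large_sets_le.
- rewrite -[X in _ --> X]subr0 -[X in _ --> _ - X](mulr0 (2 * m ^ 2)%:R).
  by apply: cvgB; [exact: cvg_cst|apply: cvgMl_tmp; exact: natr_inv_cvg0].
- exact: cvg_cst.
Unshelve. all: by end_near. Qed.

Lemma variance_ratio_cvg (R : realType) (p : nat) :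
  variance_ratio R p n @[n --> \oo] --> (1 : R).
Proof.
have q1 := large_sets_cvg R p.+1.
(* The limit takes the shape of [variance_ratio], with q replaced by 1 and both 4^-n and 1/n by
   0. *)
have -> : 1 = (1 * (1 * 1) - 1 * 0) / (1 + (p`! ^ 2 * p.+1)%:R * 0) :> R.
  by rewrite !mulr0 addr0 subr0 !mulr1 divr1.
apply: cvgM; first apply: cvgB.
- by apply: cvgM => //; apply: cvgM.
- apply: cvgM => //.
  under eq_fun do rewrite -exprVn.
  by apply: cvg_expr; rewrite ger0_norm ?invf_lt1 // ltr1n.
- apply: cvgV; first by rewrite mulr0 addr0 oner_eq0.
  apply: cvgD; first exact: cvg_cst.
  by apply: cvgMl_tmp; exact: natr_inv_cvg0.
Qed.

Lemma error_term_cvg (R : realType) (m : nat) :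
  error_term R m @ \oo --> (0 : R).
Proof.
have -> : 0 = 1 - 1 - 0 :> R by rewrite subrr subr0.
apply: cvgB; last exact: natr_inv_cvg0.
by apply: cvgB; [exact: variance_ratio_cvg|exact: cvg_cst].
Qed.

(** * Passage from integers to reals, and conclusion *)

Lemma evaluation_intr (R : realType) (n m : nat) (Sigma : 'I_n -> int)
    (A : {set 'I_n}) :
  evaluation m (fun i => (Sigma i)%:~R) A = (evaluation m Sigma A)%:~R :> R.
Proof.
by rewrite /evaluation rmorph_sum; apply: eq_bigr => B _; rewrite rmorph_prod.
Qed.

(** Distinct integers differ by at least 1, so the integer case is an instance of the real one. *)
Lemma evaluation_distinct_intr (R : realType) (n m : nat)
    (Sigma : 'I_n -> int) :
  evaluation_distinct_int m Sigma ->
  evaluation_distinct_real m (fun i => (Sigma i)%:~R : R).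
Proof.
move=> distinct A A' hA hA' /(distinct A A' hA hA') neq.
rewrite !evaluation_intr -intrB -intr_norm ler1z.
by rewrite -gtz0_ge1 normr_gt0 subr_eq0.
Qed.

Theorem theorem2p1 (R : realType) (m : nat) (hm : (1 <= m)%N) :
  (exists2 o1 : nat -> R, o1 @ \oo --> (0 : R) &
     forall (n : nat) (Sigma : 'I_n -> int) (M : R), (1 <= n)%N ->
       evaluation_distinct_int m Sigma ->
       bounded_seq M (fun i => (Sigma i)%:~R) ->
       M > main_term R m n * (1 + o1 n)) /\
  (exists2 o1 : nat -> R, o1 @ \oo --> (0 : R) &
     forall (n : nat) (Sigma : 'I_n -> R) (M : R), (1 <= n)%N ->
       evaluation_distinct_real m Sigma ->
       bounded_seq M Sigma ->
       M > main_term R m n * (1 + o1 n)).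
Proof.
(* One witness serves both cases; it depends on m and n only, hence is uniform in [Sigma] and
   [M]. *)
split; exists (error_term R m); try exact: error_term_cvg.
- move=> n Sigma M n0 /(evaluation_distinct_intr R) distinct bounded.
  exact: main_term_lt_bound n0 distinct bounded.
- by move=> n Sigma M n0 distinct bounded; exact: main_term_lt_bound bounded.
Qed.
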